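(* Let $X$ be a set of cardinality greater than $1$. Then the category $\mathcal{G}_{\underline{\Pi}_X}$ of $\underline{\Pi}_X$-graphs does not have exponentials, i.e. there are objects $G,H$ for which no exponential object $G^H$ exists.
   Context: For a set $X$, the symmetric $X$-power functor $\underline{\Pi}_X:\mathbf{Set}\to\mathbf{Set}$ sends a set $Y$ to the quotient of $Y^X$ by the action of the group $\mathrm{Aut}(X)$ of bijections of $X$ by permutation of coordinates ($g\sim g\circ\sigma$), and acts on maps by post-composition. The category $\mathcal{G}_{\underline{\Pi}_X}$ is the comma category $\mathbf{Set}\downarrow\underline{\Pi}_X$: an object $(E,V,\varphi)$ consists of sets $E$ (edges), $V$ (vertices) and a map $\varphi:E\to\underline{\Pi}_X(V)$; a morphism $(E,V,\varphi)\to(E',V',\varphi')$ is a pair of maps $f_E:E\to E'$, $f_V:V\to V'$ with $\varphi'\circ f_E=\underline{\Pi}_X(f_V)\circ\varphi$. *)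

(* Defs.v *)
From mathcomp Require Import all_boot generic_quotient.
From mathcomp Require Import boolp.

Set Implicit Arguments.
Unset Strict Implicit.
Unset Printing Implicit Defensive.

Local Open Scope quotient_scope.

Record category := Category {
  ob :> Type;
  hom : ob -> ob -> Type;
  idm : forall A, hom A A;
  cmp : forall A B C, hom B C -> hom A B -> hom A C;
  cmp1m : forall A B (f : hom A B), cmp (idm B) f = f;
  cmpm1 : forall A B (f : hom A B), cmp f (idm A) = f;
  cmpA : forall A B C D (h : hom C D) (g : hom B C) (f : hom A B),
    cmp h (cmp g f) = cmp (cmp h g) f
}.

Arguments hom {c}.
Arguments idm {c}.
Arguments cmp {c A B C}.

Record functor (C D : category) := Functor {
  fob :> C -> D;
  fmap : forall A B : C, hom A B -> hom (fob A) (fob B);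
  fmap1 : forall A : C, fmap (idm A) = idm (fob A);
  fmapD : forall (A B E : C) (g : hom B E) (f : hom A B),
    fmap (cmp g f) = cmp (fmap g) (fmap f)
}.

Arguments fmap {C D} _ {A B}.

Record product (C : category) (A B : C) := Product {
  prod_ob :> C;
  prod_fst : hom prod_ob A;
  prod_snd : hom prod_ob B;
  pairing : forall Q : C, hom Q A -> hom Q B -> hom Q prod_ob;
  pairing_fst : forall (Q : C) (f : hom Q A) (g : hom Q B),
    cmp prod_fst (pairing f g) = f;
  pairing_snd : forall (Q : C) (f : hom Q A) (g : hom Q B),
    cmp prod_snd (pairing f g) = g;
  pairing_uniq : forall (Q : C) (u : hom Q prod_ob),
    u = pairing (cmp prod_fst u) (cmp prod_snd u)
}.

Arguments prod_fst {C A B}.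
Arguments prod_snd {C A B}.
Arguments pairing {C A B} _ {Q}.

(* Z with ev : Z x H -> G is an exponential G^H: every f : A x H -> G factors
   as ev o (t x id_H) for a unique t : A -> Z.  Products are given by their
   universal property, so no choice of products is involved. *)
Definition is_exponential (C : category) (G H Z : C) (P : product Z H)
    (ev : hom (prod_ob P) G) : Prop :=
  forall (A : C) (Q : product A H) (f : hom (prod_ob Q) G),
    exists! t : hom A Z,
      cmp ev (pairing P (cmp t (prod_fst Q)) (prod_snd Q)) = f.

Definition has_exponential (C : category) (G H : C) : Prop :=
  exists (Z : C) (P : product Z H) (ev : hom (prod_ob P) G),
    is_exponential ev.

Definition SET : category :=
  @Category Type (fun A B => A -> B) (fun A => id)
    (fun A B C (g : B -> C) (f : A -> B) => g \o f)
    (fun A B f => erefl) (fun A B f => erefl) (fun A B C D h g f => erefl).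

Section GraphCategory.
Variable F : functor SET SET.

Record graph := Graph {
  edge : SET;
  vertex : SET;
  incidence : hom edge (F vertex)
}.

Arguments incidence : clear implicits.

Record graph_hom (G H : graph) := GraphHom {
  on_edge : hom (edge G) (edge H);
  on_vertex : hom (vertex G) (vertex H);
  on_incidence :
    cmp (incidence H) on_edge = cmp (fmap F on_vertex) (incidence G)
}.

Lemma graph_hom_eq (G H : graph) (f g : graph_hom G H) :
  on_edge f = on_edge g -> on_vertex f = on_vertex g -> f = g.
Proof.
case: f g => [fe fv fi] [ge gv gi] /= eqe eqv.
by subst; congr GraphHom; exact: Prop_irrelevance.
Qed.

Lemma graph_id_subproof (G : graph) :
  cmp (incidence G) (idm (edge G)) =
    cmp (fmap F (idm (vertex G))) (incidence G).
Proof. by rewrite fmap1. Qed.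

Definition graph_id (G : graph) : graph_hom G G :=
  GraphHom (graph_id_subproof G).

Lemma graph_comp_subproof (G H K : graph)
    (g : graph_hom H K) (f : graph_hom G H) :
  cmp (incidence K) (cmp (on_edge g) (on_edge f)) =
    cmp (fmap F (cmp (on_vertex g) (on_vertex f))) (incidence G).
Proof.
by rewrite cmpA on_incidence -cmpA on_incidence fmapD cmpA.
Qed.

Definition graph_comp (G H K : graph)
    (g : graph_hom H K) (f : graph_hom G H) : graph_hom G K :=
  GraphHom (graph_comp_subproof g f).

Definition graphs : category.
Proof.
refine (@Category graph graph_hom graph_id graph_comp _ _ _).
- by move=> G H f; apply: graph_hom_eq.
- by move=> G H f; apply: graph_hom_eq.
- by move=> G H K L h g f; apply: graph_hom_eq.
Defined.

(* Binary products of F-graphs exist, for every F: the edges of G x H lying over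
   edges e of G and d of H are all the elements of F (V_G x V_H) projecting
   onto the incidences of e and d.  Hence the failure of exponentials is never
   due to a missing product. *)
Section Products.
Variables G H : graph.

Let VGH : SET := (vertex G * vertex H)%type.
Let mapF (A B : Type) (h : A -> B) : F A -> F B := fmap F (h : @hom SET A B).

Record prod_edge := ProdEdge {
  pe_fst : edge G;
  pe_snd : edge H;
  pe_inc : F VGH;
  pe_fstP : incidence G pe_fst = mapF (@fst _ _ : VGH -> vertex G) pe_inc;
  pe_sndP : incidence H pe_snd = mapF (@snd _ _ : VGH -> vertex H) pe_inc
}.

Lemma prod_edge_eq (x y : prod_edge) :
  pe_fst x = pe_fst y -> pe_snd x = pe_snd y -> pe_inc x = pe_inc y -> x = y.
Proof.
case: x y => [a b c p q] [a' b' c' p' q'] /= e1 e2 e3; subst.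
by congr ProdEdge; exact: Prop_irrelevance.
Qed.

Definition prod_graph : graph := @Graph prod_edge VGH pe_inc.

Definition prod_graph_fst : graph_hom prod_graph G.
Proof.
refine (@GraphHom prod_graph G pe_fst (@fst _ _) _).
by apply: funext => x; exact: pe_fstP.
Defined.

Definition prod_graph_snd : graph_hom prod_graph H.
Proof.
refine (@GraphHom prod_graph H pe_snd (@snd _ _) _).
by apply: funext => x; exact: pe_sndP.
Defined.

Let mapF_comp (A B D : Type) (g : B -> D) (f : A -> B) (x : F A) :
  mapF g (mapF f x) = mapF (g \o f) x.
Proof.
by rewrite /mapF; have /= -> := @fmapD _ _ F _ _ _ (g : @hom SET B D) f.
Qed.

Definition prod_graph_pair (K : graph)
  (f : graph_hom K G) (g : graph_hom K H) : graph_hom K prod_graph.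
Proof.
pose v (x : vertex K) : VGH := (on_vertex f x, on_vertex g x).
unshelve refine (@GraphHom K prod_graph
  (fun k => @ProdEdge (on_edge f k) (on_edge g k) (mapF v (incidence K k)) _ _)
  v _).
- by rewrite mapF_comp; exact: (congr1 (@^~ k) (on_incidence f)).
- by rewrite mapF_comp; exact: (congr1 (@^~ k) (on_incidence g)).
- by [].
Defined.

Definition graph_product : product (G : graphs) (H : graphs).
Proof.
refine (@Product graphs G H prod_graph prod_graph_fst prod_graph_snd
  prod_graph_pair _ _ _).
- by move=> K f g; apply: graph_hom_eq.
- by move=> K f g; apply: graph_hom_eq.
- move=> K u.
  have ev : on_vertex u =
      (fun x => ((on_vertex u x).1, (on_vertex u x).2)).
    by apply: funext => x; case: (on_vertex u x).
  apply: graph_hom_eq => //.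
  apply: funext => k; apply: prod_edge_eq => //=.
  by rewrite -ev; exact: (congr1 (@^~ k) (on_incidence u)).
Defined.

End Products.
End GraphCategory.

Section SymmetricPower.
Variable X : Type.

(* [bijective] provides a two-sided inverse, so s ranges over Aut(X). *)
Definition sym_rel (Y : Type) : rel {classic (X -> Y)} :=
  fun g h => `[< exists2 s : X -> X, bijective s & g = h \o s >].

Lemma sym_rel_equiv (Y : Type) : equiv_class_of (@sym_rel Y).
Proof.
split.
- by move=> g; apply/asboolP; exists id => //; exists id.
- suff sym g h : @sym_rel Y g h -> sym_rel h g.
    by move=> g h; apply/idP/idP; exact: sym.
  move=> /asboolP[s [t st ts] ->]; apply/asboolP; exists t; first by exists s.
  by apply: funext => x /=; rewrite ts.
- move=> g f h /asboolP[s bs ->] /asboolP[t bt ->].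
  by apply/asboolP; exists (t \o s) => //; exact: bij_comp.
Qed.

Canonical sym_equiv (Y : Type) := EquivRelPack (@sym_rel_equiv Y).

Definition sym_power (Y : Type) : Type := {eq_quot (@sym_equiv Y)}.

Definition sym_class (Y : Type) (g : X -> Y) : sym_power Y :=
  \pi_({eq_quot (@sym_equiv Y)}) (g : {classic (X -> Y)}).

Definition sym_map (Y Y' : Type) (h : Y -> Y') (q : sym_power Y) :
    sym_power Y' :=
  sym_class (h \o (repr (q : {eq_quot (@sym_equiv Y)}) : X -> Y)).

Lemma sym_classP (Y : Type) (g h : X -> Y) :
  sym_class g = sym_class h <->
  exists2 s : X -> X, bijective s & g = h \o s.
Proof.
split=> [/eqmodP/asboolP //|gh].
by apply/eqmodP/asboolP.
Qed.

Lemma sym_class_surj (Y : Type) (q : sym_power Y) :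
  exists g : X -> Y, q = sym_class g.
Proof. by exists (repr (q : {eq_quot (@sym_equiv Y)})); rewrite /sym_class reprK. Qed.

(* [sym_map] does not depend on the representatives. *)
Lemma sym_mapE (Y Y' : Type) (h : Y -> Y') (g : X -> Y) :
  sym_map h (sym_class g) = sym_class (h \o g).
Proof.
rewrite /sym_map; set r : X -> Y := repr _.
have /sym_classP[s bs rE] : sym_class r = sym_class g.
  by rewrite /sym_class reprK.
by apply/sym_classP; exists s => //; rewrite rE.
Qed.

Definition sym_power_functor : functor SET SET.
Proof.
refine (@Functor SET SET sym_power sym_map _ _).
- by move=> Y; apply: funext => q; have [g ->] := sym_class_surj q;
    rewrite sym_mapE.
- by move=> Y Y' Y'' h' h; apply: funext => q; have [g ->] := sym_class_surj q;
    rewrite /= !sym_mapE.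
Defined.

End SymmetricPower.

(* Main.v *)
Require Import Defs.
From mathcomp Require Import all_boot boolp.

Set Implicit Arguments.
Unset Strict Implicit.
Unset Printing Implicit Defensive.

(** An exponential G^H forces the functor - x H to preserve quotients, and
    quotients that glue vertices break this.  Let H be the graph with vertex
    set X and a single edge, incident to all of X.  An edge of H x H is, up to
    reparametrization, the graph of a bijection of X, so there are at least two
    of them when X has two points.  Gluing all the vertices of the left factor
    turns it into a loop L, and L x H has only one edge: the projections of all
    bijections to the second coordinate agree up to reparametrization.

    Let G have one vertex and two loops.  Some f : H x H -> G separates the
    edge of the identity from that of a transposition [twisted_edge_neq].  If
    Z were an exponential G^H, then f would be induced by some t : H -> Z.  But
    a vertex of Z amounts to a map of vertex sets from that of H to that of G,
    so Z has at most one vertex [exponential_one_vertex].  Hence t factors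
    through L, so f factors through L x H, where the two edges have become
    equal [glued_edges_eq]: a contradiction. *)

Lemma pairing_cmp (C : category) (A B : C) (P : product A B) (Q R : C)
    (f : hom R A) (g : hom R B) (h : hom Q R) :
  pairing P (cmp f h) (cmp g h) = cmp (pairing P f g) h.
Proof.
by rewrite [RHS]pairing_uniq !cmpA pairing_fst pairing_snd.
Qed.

Section OneVertex.
Variable F : functor SET SET.

Definition point_graph : graphs F :=
  @Graph F void unit (fun e : void => match e with end).

Definition vertex_hom (Z : graphs F) (z : vertex Z) : hom point_graph Z.
Proof.
refine (@GraphHom F point_graph Z (fun e : void => match e with end)
  (fun=> z) _).
by apply: funext; case.
Defined.

(** Two vertices u, v of Z are two maps from the edgeless one-vertex graph to Z.
    Their transposes are maps from an edgeless graph to G, hence equal, and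
    u = v by the uniqueness of transposes. *)
Lemma exponential_one_vertex (G H Z : graphs F) (P : product Z H)
    (ev : hom (prod_ob P) G) :
  is_exponential ev -> (forall x y : vertex G, x = y) ->
  forall u v : vertex Z, u = v.
Proof.
move=> expZ G1 u v.
pose Q := graph_product point_graph H.
have Qhom_eq (g h : graph_hom (prod_ob Q) G) : g = h.
  by apply: graph_hom_eq; apply: funext => x; [case: (pe_fst x) | exact: G1].
pose transpose (z : vertex Z) : hom (prod_ob Q) G :=
  cmp ev (pairing P (cmp (vertex_hom z) (prod_fst Q)) (prod_snd Q)).
have [t [_ t_uniq]] := expZ point_graph Q (transpose u).
have tu := t_uniq (vertex_hom u) erefl.
have tv := t_uniq (vertex_hom v) (Qhom_eq _ _).
have uv : vertex_hom u = vertex_hom v by rewrite -tu -tv.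
exact: (congr1 (fun h : graph_hom point_graph Z => on_vertex h tt) uv).
Qed.

End OneVertex.

Lemma transposition_exists (X : Type) (a b : X) :
  exists2 s : X -> X, bijective s & s a = b.
Proof.
pose s x := if `[< x = a >] then b else if `[< x = b >] then a else x.
exists s; last by rewrite /s; case: asboolP.
by exists s => x; rewrite /s; do !(case: asboolP => //; try congruence).
Qed.

Section Glueing.
Variable X : Type.
Let F := sym_power_functor X.

Definition full_edge : graphs F := @Graph F unit X (fun=> sym_class id).

Definition loop : graphs F := @Graph F unit unit (fun=> sym_class (fun=> tt)).

Definition two_loops : graphs F :=
  @Graph F bool unit (fun=> sym_class (fun=> tt)).

Lemma sym_power_unit (q : sym_power X unit) : q = sym_class (fun=> tt).
Proof.
have [g ->] := sym_class_surj q; congr sym_class.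
by apply: funext => x; case: (g x).
Qed.

Definition glue : hom full_edge loop.
Proof.
refine (@GraphHom F full_edge loop id (fun=> tt) _).
by apply: funext => e; rewrite [RHS]sym_power_unit.
Defined.

Definition twisted_edge (s : X -> X) (bs : bijective s) :
  prod_edge full_edge full_edge.
Proof.
refine (@ProdEdge F full_edge full_edge tt tt
  (sym_class (fun x => (x, s x))) _ _).
- by rewrite /= sym_mapE.
- by rewrite /= sym_mapE; apply/esym/sym_classP; exists s.
Defined.

Lemma twisted_edge_neq (s t : X -> X) (bs : bijective s) (bt : bijective t) x :
  s x <> t x -> pe_inc (twisted_edge bs) <> pe_inc (twisted_edge bt).
Proof.
move=> st /sym_classP[r _ E].
(* The first coordinates force the reparametrization r to fix x. *)
by case: (congr1 (@^~ x) E) => <- /st.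
Qed.

(** After the first coordinates are glued, the edge of s is the edge of the
    identity reparametrized by s. *)
Lemma glued_edges_eq (s t : X -> X) (bs : bijective s) (bt : bijective t) :
  let Q := graph_product full_edge full_edge in
  let h : graph_hom (prod_ob Q) (prod_ob (graph_product loop full_edge)) :=
    pairing (graph_product loop full_edge)
      (cmp glue (prod_fst Q)) (prod_snd Q) in
  on_edge h (twisted_edge bs) = on_edge h (twisted_edge bt).
Proof.
apply: prod_edge_eq => //=; rewrite !sym_mapE.
have untwist (r : X -> X) : bijective r ->
    sym_class (fun x => (tt, r x)) = sym_class (fun x : X => (tt, x)).
  by move=> br; apply/sym_classP; exists r.
by rewrite [LHS](untwist s bs) [RHS](untwist t bt).
Qed.

Lemma hom_factors_glue (Z : graphs F) (t : hom full_edge Z) (z : vertex Z) :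
  (forall x, on_vertex t x = z) ->
  exists t' : hom loop Z, t = cmp t' glue.
Proof.
move=> tz.
have inc : cmp (@incidence F Z) (on_edge t) =
    cmp (fmap F (fun=> z)) (@incidence F loop).
  have tE : on_vertex t = (fun=> z) by exact: funext.
  by rewrite on_incidence tE; apply: funext => e; rewrite /= !sym_mapE.
exists (@GraphHom F loop Z (on_edge t) (fun=> z) inc).
by apply: graph_hom_eq => //; exact: funext.
Qed.

(** The symmetric power of a point is a point, so any labelling of edges by the
    two loops is a homomorphism. *)
Definition detect_diagonal :
  hom (prod_ob (graph_product full_edge full_edge)) two_loops.
Proof.
refine (@GraphHom F (prod_graph full_edge full_edge) two_loops
  (fun e => `[< pe_inc e = sym_class (fun x : X => (x, x)) >]) (fun=> tt) _).
by apply: funext => e; rewrite [RHS]sym_power_unit.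
Defined.

End Glueing.

Theorem corollaryC (X : Type) (hX : exists x y : X, x <> y) :
  exists G H : graphs (sym_power_functor X), ~ has_exponential G H.
Proof.
case: hX => a [b ab].
exists (two_loops X), (full_edge X) => -[Z [P [ev expZ]]].
have Z1 := exponential_one_vertex expZ (fun 'tt 'tt => erefl).
pose Q := graph_product (full_edge X) (full_edge X).
have [t [tE _]] := expZ _ Q (detect_diagonal X).
have [t' tt'] := hom_factors_glue (fun x => Z1 (on_vertex t x) (on_vertex t a)).
have [s bs sa] := transposition_exists a b.
have bid : bijective (@id X) by exists id.
pose R := graph_product (loop X) (full_edge X).
pose h := pairing R (cmp (glue X) (prod_fst Q)) (prod_snd Q).
have fE : detect_diagonal X = cmp (cmp ev (pairing P (cmp t' (prod_fst R))
    (prod_snd R))) h.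
  rewrite -cmpA -pairing_cmp -cmpA /h pairing_fst pairing_snd -tE.
  by rewrite cmpA tt'.
have : on_edge (detect_diagonal X) (twisted_edge bs) =
       on_edge (detect_diagonal X) (twisted_edge bid).
  rewrite fE; set k := (X in cmp X h).
  exact: (congr1 (on_edge (k : graph_hom _ _)) (glued_edges_eq bs bid)).
rewrite /= (asboolT erefl) => /asboolP.
by apply: (twisted_edge_neq (bs := bs) (bt := bid) (x := a)); rewrite sa => /esym.
Qed.
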